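(* Let $G=\bigcup_{i\ge1}G_i$ be the direct limit of the groups $G_1\le G_2\le\cdots$ of the construction described in the context (for any sequence of primes with $p_{i+1}\ne p_i$ and any choices of the extra-special groups $M_i$). Then $G$ is periodic, locally soluble, residually finite, and hereditarily just infinite (i.e. $G$ is infinite and every subgroup of finite index in $G$ is just infinite).
   Context: An infinite group is just infinite if every proper quotient of it is finite. For a group $X$ acted on by $Y$, $[X,Y]$ is generated by all $x^{-1}x^{y}$. A finite $p$-group $P$ is extra-special if $P'=Z(P)$ has order $p$. Construction: let $p_1,p_2,\dots$ be an infinite sequence of primes with $p_{i+1}\ne p_i$ for all $i$. Define finite groups $G_1\le G_2\le\cdots$ and subgroups $R_i\le G_i$ recursively. Let $G_1=R_1$ be cyclic of order $p_1$. For $i\ge2$: let $M_i$ be an extra-special group of order $p_i^3$; let $B$ be the base group of the regular wreath product $M_i\wr G_{i-1}$ (direct product of $|G_{i-1}|$ copies of $M_i$, permuted regularly by $G_{i-1}$); let $B_i=B/[B',G_{i-1}]$ with the induced $G_{i-1}$-action; $D_i=[B_i,R_{i-1}]$; $G_i=D_i\rtimes G_{i-1}$; $R_i=D_i'$. *)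

(* Defs.v *)
From HB Require Import structures.
From mathcomp Require Import all_boot all_order all_fingroup all_solvable all_algebra.

Set Implicit Arguments.
Unset Strict Implicit.
Unset Printing Implicit Defensive.

Local Open Scope group_scope.

Section InfiniteGroups.
Variable X : groupType.
Implicit Types (H K N A : X -> Prop).

Definition is_subgroup H := H 1 /\ (forall x y, H x -> H y -> H (x * y^-1)).

Definition normal_sub N H :=
  (forall x, N x -> H x) /\ (forall n h, N n -> H h -> N (n ^ h)).

Definition fin_index K H :=
  exists s : seq X, forall h, H h -> exists2 t, t \in s & K (h * t^-1).

Definition infinite_set H := forall s : seq X, exists x, H x /\ x \notin s.

Definition just_infinite H :=
  infinite_set H /\
  forall N, is_subgroup N -> normal_sub N H -> (exists n, N n /\ n <> 1) ->
    fin_index N H.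

Definition setT_pred : X -> Prop := fun _ => True.

Definition hereditarily_just_infinite :=
  infinite_set setT_pred /\
  forall K, is_subgroup K -> fin_index K setT_pred -> just_infinite K.

Definition periodic_group := forall x : X, exists2 n, (0 < n)%N & x ^+ n = 1.

Definition gen_sub A : X -> Prop :=
  fun x => forall K, is_subgroup K -> (forall a, A a -> K a) -> K x.

Definition derived_sub H : X -> Prop :=
  gen_sub (fun x => exists a b, H a /\ H b /\ x = [~ a, b]).

Definition soluble_sub H := exists n, forall x, iter n derived_sub H x -> x = 1.

Definition locally_soluble :=
  forall s : seq X, soluble_sub (gen_sub (fun x => x \in s)).

Definition residually_finite :=
  forall x : X, x <> 1 -> exists N, [/\ is_subgroup N, normal_sub N setT_pred,
    fin_index N setT_pred & ~ N x].

End InfiniteGroups.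

Definition extra_special (p : nat) (gT : finGroupType) (P : {set gT}) :=
  [/\ p.-group P, P^`(1) = 'Z(P) & #|'Z(P)| = p].

(* Regular wreath product Mt wr H, as pairs (f, h) with f : H -> Mt (the base
   group) and h : H; (f1,h1)(f2,h2) = (x |-> f1 x * f2 (x * h1), h1 h2).
   Conjugating (f,1) by (1,h) gives (x |-> f (x h^-1), 1): coordinates are
   permuted by the right regular action of H. *)
Section Wreath.
Variables (Mt H : finGroupType).

Definition wreath_t := ({ffun H -> Mt} * H)%type.
HB.instance Definition _ := Finite.on wreath_t.

Definition wr_one : wreath_t := ([ffun=> 1], 1).
Definition wr_mul (u v : wreath_t) : wreath_t :=
  ([ffun x => u.1 x * v.1 (x * u.2)], u.2 * v.2).
Definition wr_inv (u : wreath_t) : wreath_t :=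
  ([ffun y => (u.1 (y * u.2^-1))^-1], u.2^-1).

Lemma wr_mulgA : associative wr_mul.
Proof.
move=> [f1 h1] [f2 h2] [f3 h3]; rewrite /wr_mul /=; congr (_, _); last first.
  by rewrite mulgA.
by apply/ffunP => x; rewrite !ffunE mulgA mulgA.
Qed.

Lemma wr_mul1g : left_id wr_one wr_mul.
Proof.
move=> [f h]; rewrite /wr_mul /=; congr (_, _); last by rewrite mul1g.
by apply/ffunP => x; rewrite !ffunE mul1g mulg1.
Qed.

Lemma wr_mulVg : left_inverse wr_one wr_inv wr_mul.
Proof.
move=> [f h]; rewrite /wr_mul /wr_one /=; congr (_, _); last by rewrite mulVg.
by apply/ffunP => x; rewrite !ffunE mulVg.
Qed.

HB.instance Definition _ := Finite_isGroup.Build wreath_t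
  wr_mulgA wr_mul1g wr_mulVg.

Definition wreath : finGroupType := wreath_t.

Definition wr_base : {group wreath} :=
  <<[set u : wreath | u.2 == (1 : H)%g]>>%G.
Definition wr_top : {group wreath} := <<[set u : wreath | u.1 == [ffun=> (1 : Mt)%g]]>>%G.
Definition wr_top_of (A : {set H}) : {group wreath} :=
  <<[set u : wreath | (u.1 == [ffun=> (1 : Mt)%g]) && (u.2 \in A)]>>%G.

End Wreath.

Record stage := Stage {
  st_type : finGroupType;
  st_G : {group st_type};
  st_R : {group st_type}
}.

Section Step.
Variables (Mt : finGroupType) (s : stage).

Definition step_Htype : finGroupType := subg_of (st_G s).
Definition step_W : finGroupType := wreath Mt step_Htype.
Definition step_base : {group step_W} := wr_base Mt step_Htype.
Definition step_topW : {group step_W} := wr_top Mt step_Htype.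
Definition step_N : {group step_W} := [~: step_base^`(1), step_topW]%G.
Definition step_RW : {group step_W} :=
  wr_top_of Mt (subg (st_G s) @: (st_R s)).

Definition step_type : finGroupType := coset_of step_N.
Definition step_B : {group step_type} := (step_base / step_N)%G.
Definition step_top : {group step_type} := (step_topW / step_N)%G.
Definition step_D : {group step_type} := [~: step_B, (step_RW / step_N)%G]%G.
Definition step_G : {group step_type} := (step_D <*> step_top)%G.
Definition step_R : {group step_type} := (step_D^`(1))%G.

Definition stage_step : stage := @Stage step_type step_G step_R.

Definition stage_emb (g : st_type s) : step_type :=
  coset step_N (([ffun=> 1], subg (st_G s) g) : step_W).

End Step.

Definition stage1 (p : nat) : stage := @Stage _ (Zp p)%G (Zp p)%G.

Section Tower.
Variables (p : nat -> nat) (M : nat -> finGroupType).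

(* tower i = (G_i, R_i) for i >= 1 (tower 0 is an unused dummy) *)
Fixpoint tower (n : nat) : stage :=
  match n with
  | 0 | 1 => stage1 (p 1)
  | S m => stage_step (M n) (tower m)
  end.

Definition tower_emb (k : nat) :
  st_type (tower k.+1) -> st_type (tower k.+2) :=
  @stage_emb (M k.+2) (tower k.+1).

End Tower.

(* Main.v *)
(** Write G_i = D_i G_(i-1), where D_i = [B_i, R_(i-1)].  Since R_(i-1) has
    order prime to p_i, one has D_i = [D_i, R_(i-1)], and D_i is extra-special
    with centre D_i' = R_i = B_i'; its order p_i comes from the identification
    of B'/[B', G_(i-1)] with the coinvariants of F_p[G_(i-1)].  By induction
    R_(i-1) lies in every nontrivial normal subgroup of G_(i-1), so G_(i-1) acts
    faithfully on D_i / D_i', whence C_(G_i)(D_i) <= D_i.  Therefore a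
    nontrivial subgroup of G_i normalised by D_i meets Z(D_i) = R_i, that is,
    contains R_i.

    Let now N be a nontrivial subgroup of the union G which is normalised by D_i
    for all large i.  For large i it contains R_i, hence also
    D_(i+1) = [D_(i+1), R_i]; so N contains almost all D_i and has finite index
    in G.  Apply this first to the core of a subgroup K of finite index, which
    is nontrivial because G is infinite, and then to any nontrivial normal
    subgroup of K. *)

Require Import Defs.
From HB Require Import structures.
From mathcomp Require Import all_boot all_fingroup all_solvable ssralg zmodp.

Set Implicit Arguments.
Unset Strict Implicit.
Unset Printing Implicit Defensive.

Import GRing.Theory.
Local Open Scope group_scope.

(** * Monolithic extensions by a coprime commutator *)

Section CoprimeAction.

Variables (gT : finGroupType) (E R : {group gT}).
Hypotheses (nER : R \subset 'N(E)) (coER : coprime #|E| #|R|).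
Hypothesis solE : solvable E.

Lemma coprime_comm_mul_cent : [~: E, R] * 'C_E(R) = E.
Proof.
have sDE : [~: E, R] \subset E by rewrite commg_subl.
have nDR : R \subset 'N([~: E, R]) by exact: commg_normr.
apply/eqP; rewrite eqEsubset mul_subG ?subsetIl //=.
rewrite -quotientSK ?commg_norml //= coprime_quotient_cent //.
by rewrite subsetI subxx quotient_cents2r.
Qed.

Lemma coprime_comm_idem : [~: E, R, R] = [~: E, R].
Proof.
have c1 : [~: 'C_E(R), R] = 1 by apply/commG1P; exact: subsetIr.
have := commMG (G := [~: E, R]%G) (H := 'C_E(R)%G) (K := R).
rewrite /= coprime_comm_mul_cent c1 mulg1 => <- //.
rewrite normsR ?(subset_trans (subsetIl _ _) (commg_norml _ _)) //.
by rewrite cents_norm ?subsetIr.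
Qed.

End CoprimeAction.

Section MonolithicExtension.

Variables (gT : finGroupType) (E H R : {group gT}) (p : nat).
Hypotheses (pr_p : prime p) (pE : p.-group E) (derE : E^`(1) = 'Z(E)).
Hypotheses (oderE : #|E^`(1)| = p) (nEH : H \subset 'N(E)).
Hypothesis cEH : H \subset 'C(E^`(1)).
Hypotheses (nsRH : R <| H) (coER : coprime #|E| #|R|).
Hypothesis ncER : ~~ (R \subset 'C(E)).
Hypothesis monoR : forall K : {group gT}, K <| H -> K :!=: 1 -> R \subset K.

Let D := [~: E, R]%G.
Let sRH : R \subset H. Proof. exact: normal_sub nsRH. Qed.
Let nER : R \subset 'N(E). Proof. exact: subset_trans sRH nEH. Qed.
Let sDE : D \subset E. Proof. by rewrite commg_subl. Qed.
Let solE : solvable E. Proof. exact: pgroup_sol pE. Qed.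
Let idD : [~: D, R] = D. Proof. exact: coprime_comm_idem. Qed.

Lemma comm_neq1 : D :!=: 1.
Proof. by apply: contra ncER => /eqP/commG1P; rewrite centsC. Qed.

Lemma comm_norm : H \subset 'N(D).
Proof. by rewrite normsR // normal_norm. Qed.

Lemma comm_not_sub_der : ~~ (D \subset E^`(1)).
Proof.
apply: contra comm_neq1 => sDE'; rewrite -idD; apply/eqP/commG1P.
by rewrite centsC; apply: subset_trans sRH (subset_trans cEH (centS sDE')).
Qed.

(* Three subgroups lemma, as [C_E(R), E, R] lies in [E', R] = 1. *)
Lemma subcent_cent_comm : 'C_E(R) \subset 'C(D).
Proof.
rewrite centsC; apply/commG1P; apply: three_subgroup.
  have -> : [~: R, 'C_E(R)] = 1 by apply/commG1P; rewrite centsC subsetIr.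
  by apply/commG1P; rewrite sub1G.
apply/commG1P; rewrite centsC (subset_trans sRH) // (subset_trans cEH) //.
by rewrite centS // commSg // subsetIl.
Qed.

Lemma center_comm_sub : 'Z(D) \subset E^`(1).
Proof.
rewrite derE subsetI (subset_trans (center_sub D)) //=.
rewrite -[X in 'C(X)](coprime_comm_mul_cent nER coER solE) centM subsetI subsetIr.
by rewrite centsC (subset_trans subcent_cent_comm) // centS // center_sub.
Qed.

Lemma der_comm_eq : D^`(1) = E^`(1).
Proof.
have s1 : D^`(1) \subset E^`(1) by rewrite dergS.
apply/eqP; rewrite eqEsubset s1 /=; apply: prime_meetG; first by rewrite oderE.
rewrite (setIidPr s1); apply: contra comm_not_sub_der => /eqP/derG1P abD.
by apply: subset_trans center_comm_sub; rewrite subsetI subxx.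
Qed.

Lemma center_comm_eq : 'Z(D) = D^`(1).
Proof.
apply/eqP; rewrite eqEsubset {1}der_comm_eq center_comm_sub /=.
rewrite subsetI der_sub der_comm_eq derE centsC.
by rewrite centsC subIset // centS ?orbT.
Qed.

Lemma cent_comm_sub : 'C_(D <*> H)(D) \subset D.
Proof.
have nDH := comm_norm.
set G := D <*> H; set C := 'C_G(D)%G.
have nDG : G \subset 'N(D) by rewrite join_subG normG.
have nCG : G \subset 'N(C) by rewrite normsI ?normG ?norms_cent.
have nCD : D \subset 'N(C) by apply: subset_trans nCG; exact: joing_subl.
have dC x : x \in D <*> C -> exists2 d, d \in D & exists2 c, c \in C & x = d * c.
  by rewrite norm_joinEl // => /mulsgP[d c Dd Cc ->]; exists d => //; exists c.
have trivK : (D <*> C) :&: H = 1.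
  apply/eqP; apply: contraR comm_not_sub_der => ntK.
  have nsK : (D <*> C) :&: H <| H.
    rewrite /normal subsetIr normsI ?normG // normsY //.
    by apply: subset_trans nCG; exact: joing_subr.
  have sRK := monoR nsK ntK.
  rewrite -der_comm_eq -{1}idD gen_subG; apply/subsetP=> _ /imset2P[x r Dx Rr ->].
  have /setIP[/dC[d Dd [c /setIP[_ /centP cc] ->]] _] := subsetP sRK r Rr.
  rewrite commgMJ; have -> : [~ x, c] = 1 by apply/eqP/commgP/esym/cc.
  rewrite mul1g (conjg_fixP _) ?mem_commg //; apply/commgP/esym/cc.
  by rewrite groupR.
apply/subsetP=> x Cx; have /setIP[Gx _] := Cx.
move: Gx; rewrite /G norm_joinEr // => /mulsgP[d h Dd Hh defx].
suff h1 : h = 1 by rewrite defx h1 mulg1.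
apply/set1gP; rewrite -trivK inE Hh andbT.
have -> : h = d^-1 * x by rewrite defx mulKg.
rewrite groupM //; last exact: (subsetP (joing_subr D C)).
by rewrite groupV (subsetP (joing_subl D C)).
Qed.

Lemma der_comm_monolith (K : {group gT}) :
  K \subset D <*> H -> D \subset 'N(K) -> K :!=: 1 -> D^`(1) \subset K.
Proof.
move=> sKG nKD ntK.
have nDK : K \subset 'N(D).
  by apply: subset_trans sKG _; rewrite join_subG normG comm_norm.
have ntKD : K :&: D != 1.
  apply: contra ntK => /eqP tiKD.
  have cKD : [~: K, D] = 1.
    by apply/trivgP; rewrite -tiKD commg_subI // subsetI ?subxx ?normG.
  rewrite -subG1 -tiKD subsetI subxx (subset_trans _ cent_comm_sub) //.
  by rewrite subsetI sKG; apply/commG1P.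
have nsKD : K :&: D <| D by rewrite /normal subsetIr normsI ?normG.
have nilD : nilpotent D := pgroup_nil (pgroupS sDE pE).
have := meet_center_nil nilD nsKD ntKD.
rewrite center_comm_eq => nt.
apply: subset_trans (subsetIl K D); apply: prime_meetG.
  by rewrite /= der_comm_eq oderE.
by rewrite setIC.
Qed.

Lemma solvable_comm_ext : solvable H -> solvable (D <*> H).
Proof.
move=> solH; have nsD : D <| D <*> H.
  by rewrite /normal joing_subl join_subG normG comm_norm.
rewrite (series_sol nsD) (solvableS sDE solE) quotientYidl ?comm_norm //.
exact: quotient_sol.
Qed.

End MonolithicExtension.

(** * The wreath product *)

Section WreathElements.

Variables (Mt H : finGroupType).
Local Notation W := (wreath Mt H).
Implicit Types (u v w : W) (f : {ffun H -> Mt}) (h x y : H) (m : Mt).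

Definition wr_ffun f : W := (f, 1).
Definition wr_lift h : W := ([ffun=> 1], h).
Definition wr_at x m : W := wr_ffun [ffun y => if y == x then m else 1].

Lemma wr_mulE u v :
  u * v = ([ffun x => u.1 x * v.1 (x * u.2)], u.2 * v.2) :> W.
Proof. by []. Qed.

Lemma wr_invE u : u^-1 = ([ffun y => (u.1 (y * u.2^-1))^-1], u.2^-1) :> W.
Proof. by []. Qed.

Lemma wr_baseE w : (w \in wr_base Mt H) = (w.2 == 1).
Proof.
rewrite /= gen_set_id ?inE //; apply/group_setP; split=> [|u v]; rewrite !inE //.
by move=> /eqP u2 /eqP v2; rewrite wr_mulE /= u2 v2 mulg1.
Qed.

Lemma wr_liftM : {morph wr_lift : h k / h * k}.
Proof.
move=> h k; rewrite wr_mulE /wr_lift /=; congr (_, _).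
by apply/ffunP=> x; rewrite !ffunE mulg1.
Qed.

Lemma wr_top_ofE (A : {group H}) w :
  (w \in wr_top_of Mt A) = (w.1 == [ffun=> 1]) && (w.2 \in A).
Proof.
rewrite /= gen_set_id ?inE //; apply/group_setP; split=> [|u v]; rewrite !inE.
  by rewrite eqxx group1.
move=> /andP[/eqP u1 Au] /andP[/eqP v1 Av]; rewrite wr_mulE /= groupM // andbT.
by apply/eqP/ffunP=> x; rewrite u1 v1 !ffunE mulg1.
Qed.

Lemma wr_topE : wr_top Mt H = wr_top_of Mt [set: H].
Proof.
by apply/val_inj; congr (<<_>>); apply/setP=> w; rewrite !inE andbT.
Qed.

Lemma wr_lift_im (A : {group H}) : wr_lift @: A = wr_top_of Mt A.
Proof.
apply/setP=> w; rewrite wr_top_ofE; apply/imsetP/andP => [[h Ah ->]|[]].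
  by rewrite /= eqxx.
by case: w => f h /= /eqP-> Ah; exists h.
Qed.

Lemma wr_ffunM f g : wr_ffun f * wr_ffun g = wr_ffun [ffun x => f x * g x].
Proof.
rewrite wr_mulE /wr_ffun /= mulg1; congr (_, _).
by apply/ffunP=> x; rewrite !ffunE mulg1.
Qed.

Lemma wr_ffunV f : (wr_ffun f)^-1 = wr_ffun [ffun x => (f x)^-1].
Proof.
rewrite wr_invE /wr_ffun /= invg1; congr (_, _).
by apply/ffunP=> x; rewrite !ffunE mulg1.
Qed.

Lemma wr_ffunJ f h : wr_ffun f ^ wr_lift h = wr_ffun [ffun x => f (x * h^-1)].
Proof.
rewrite /conjg wr_invE !wr_mulE /wr_ffun /= mul1g mulVg; congr (_, _).
by apply/ffunP=> x; rewrite !ffunE /= invg1 mul1g mulg1.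
Qed.

Lemma wr_baseP w : reflect (exists f, w = wr_ffun f) (w \in wr_base Mt H).
Proof.
rewrite wr_baseE; apply: (iffP eqP) => [|[f ->]] //.
by case: w => f h /= ->; exists f.
Qed.

Lemma wr_decomp w : exists f h, w = wr_ffun f * wr_lift h.
Proof.
case: w => f h; exists f, h; rewrite wr_mulE /wr_ffun /= mul1g; congr (_, _).
by apply/ffunP=> x; rewrite !ffunE mulg1.
Qed.

Lemma wr_base_norm w : w \in 'N(wr_base Mt H).
Proof.
rewrite inE; apply/subsetP=> _ /imsetP[v Bv ->]; move: Bv.
by rewrite !wr_baseE => /eqP v2; rewrite /conjg wr_invE !wr_mulE /= v2 mul1g mulVg eqxx.
Qed.

Lemma wr_atM x : {morph wr_at x : m n / m * n}.
Proof.
move=> m n; rewrite wr_ffunM; congr wr_ffun; apply/ffunP=> y; rewrite !ffunE.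
by case: eqP; rewrite ?mulg1.
Qed.

Lemma wr_at1 x : wr_at x 1 = 1 :> W.
Proof. by apply: (mulgI (wr_at x 1)); rewrite -wr_atM !mulg1. Qed.

Lemma wr_atJ x m h : wr_at x m ^ wr_lift h = wr_at (x * h) m.
Proof.
rewrite wr_ffunJ; congr wr_ffun; apply/ffunP=> y; rewrite !ffunE.
by rewrite (canF_eq (mulgKV h)).
Qed.

Lemma wr_base_at x m : wr_at x m \in wr_base Mt H.
Proof. by apply/wr_baseP; eexists. Qed.

Lemma wr_ffun_prod f : wr_ffun f = \prod_(x : H) wr_at x (f x).
Proof.
suff prodE (r : seq H) : uniq r ->
    \prod_(x <- r) wr_at x (f x) = wr_ffun [ffun y => if y \in r then f y else 1].
  rewrite prodE ?index_enum_uniq //; congr wr_ffun; apply/ffunP=> y.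
  by rewrite ffunE mem_index_enum.
elim: r => [|x r IHr] /=; first by move=> _; rewrite big_nil.
case/andP=> xr ur; rewrite big_cons IHr // wr_ffunM; congr wr_ffun.
apply/ffunP=> y; rewrite !ffunE in_cons; case: eqP => [->|_] /=.
  by rewrite (negPf xr) mulg1.
by rewrite mul1g.
Qed.

End WreathElements.

Section WreathQuotient.

Variables (Mt H : finGroupType) (p : nat).
Hypotheses (pr_p : prime p) (esM : extra_special p [set: Mt]).

Local Notation W := (wreath Mt H).
Local Notation Z := 'Z([set: Mt]).
Let B := wr_base Mt H.
Let T := wr_top Mt H.
Let N := [~: B^`(1), T]%G.
Implicit Types (f g : {ffun H -> Mt}) (w : W).

Let pM : p.-group [set: Mt]. Proof. by case: esM. Qed.
Let derM : [set: Mt]^`(1) = Z. Proof. by case: esM. Qed.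
Let oZ : #|Z| = p. Proof. by case: esM. Qed.

Lemma wr_ffunR f g :
  [~ wr_ffun f, wr_ffun g] = wr_ffun [ffun x => [~ f x, g x]].
Proof.
rewrite /commg /conjg !wr_ffunV !wr_ffunM; congr wr_ffun.
by apply/ffunP=> x; rewrite !ffunE.
Qed.

Definition wr_base_center := [set w : W | (w.2 == 1) && [forall x, w.1 x \in Z]].

Lemma wr_base_centerP w :
  reflect (exists2 f : {ffun H -> Mt}, forall x, f x \in Z & w = wr_ffun f)
          (w \in wr_base_center).
Proof.
rewrite inE; apply: (iffP andP) => [[/eqP w2 /forallP Zw]|[f Zf ->]].
  by exists w.1; case: w w2 Zw => //= f h ->.
by split=> //; apply/forallP=> x; apply: Zf.
Qed.

Lemma wr_base_center_group_set : group_set wr_base_center.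
Proof.
apply/group_setP; split=> [|u v].
  by apply/wr_base_centerP; exists [ffun=> 1] => // x; rewrite ffunE group1.
move=> /wr_base_centerP[f Zf ->] /wr_base_centerP[g Zg ->].
apply/wr_base_centerP; exists [ffun x => f x * g x]; last by rewrite wr_ffunM.
by move=> x; rewrite ffunE groupM.
Qed.
Canonical wr_base_center_group := Group wr_base_center_group_set.

Lemma wr_base_center_cent : wr_base_center \subset 'C(B).
Proof.
apply/centsP=> u /wr_base_centerP[f Zf ->] v /wr_baseP[g ->].
rewrite /commute !wr_ffunM; congr wr_ffun; apply/ffunP=> x; rewrite !ffunE.
by have /centerP[_ ->] := Zf x; rewrite ?inE.
Qed.

Lemma der_wr_base : B^`(1) = wr_base_center.
Proof.
apply/eqP; rewrite eqEsubset; apply/andP; split.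
  rewrite gen_subG; apply/subsetP=> _ /imset2P[u v /wr_baseP[f ->] /wr_baseP[g ->] ->].
  apply/wr_base_centerP; rewrite wr_ffunR; eexists=> // x.
  by rewrite ffunE -derM mem_commg ?inE.
apply/subsetP=> w /wr_base_centerP[f Zf ->]; rewrite wr_ffun_prod.
apply: group_prod => x _; have := Zf x; rewrite -derM => Mx.
pose j := Morphism (D := [set: Mt]) (in2W (@wr_atM Mt H x)).
have : j (f x) \in j @* [set: Mt]^`(1) by rewrite mem_morphim ?inE.
rewrite morphim_der //; apply: subsetP; apply: dergS.
by apply/subsetP=> _ /morphimP[m _ _ ->]; apply: wr_base_at.
Qed.

Lemma wr_base_normT : [set: W] \subset 'N(B).
Proof. by apply/subsetP=> w _; apply: wr_base_norm. Qed.

Lemma wr_N_norm : [set: W] \subset 'N(N).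
Proof.
have nB' : [set: W] \subset 'N(B^`(1)).
  by apply: char_norm_trans wr_base_normT; apply: der_char.
apply/subsetP=> w _; have [f [h ->]] := wr_decomp w.
have Tlift : wr_lift Mt h \in T by rewrite /T wr_topE wr_top_ofE eqxx inE.
rewrite groupM //; last by apply: subsetP Tlift; apply: commg_normr.
have sNB' : N \subset B^`(1) by rewrite commg_subl (subset_trans _ nB') ?subsetT.
have Bf : wr_ffun f \in B by apply/wr_baseP; exists f.
apply: subsetP Bf; apply: cents_norm; rewrite centsC (subset_trans sNB') //.
by rewrite der_wr_base wr_base_center_cent.
Qed.

(* Logarithms to the base of a generator [z] of the centre turn the product of
   the coordinates, which the top group permutes, into a sum. *)
Section LogSum.

Variable z : Mt.
Hypothesis defZ : Z = <[z]>.

Definition wr_log : Mt -> 'Z_#[z] := invm (injm_Zpm z).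
Definition wr_logsum (w : W) : 'Z_#[z] := (\sum_(x : H) wr_log (w.1 x))%R.

Lemma wr_logM : {in Z &, {morph wr_log : m n / m * n >-> (m + n)%R}}.
Proof.
move=> m n; rewrite defZ -im_Zpm => Zm Zn.
by rewrite /wr_log morphM.
Qed.

Lemma wr_log1 : wr_log 1 = 0%R.
Proof. by rewrite /wr_log morph1. Qed.

Lemma wr_log_eq0 m : m \in Z -> wr_log m = 0%R -> m = 1.
Proof.
rewrite defZ -im_Zpm => Zm m0; have /injmP inj := injm_invm (injm_Zpm z).
by apply: inj => //; rewrite [LHS]m0 morph1.
Qed.

Lemma wr_logsumM u v : u \in wr_base_center -> v \in wr_base_center ->
  wr_logsum (u * v) = (wr_logsum u + wr_logsum v)%R.
Proof.
move=> /wr_base_centerP[f Zf ->] /wr_base_centerP[g Zg ->].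
rewrite wr_ffunM /wr_logsum -big_split; apply: eq_bigr => x _.
by rewrite ffunE wr_logM.
Qed.

Lemma wr_logsumJ f h : wr_logsum (wr_ffun f ^ wr_lift Mt h) = wr_logsum (wr_ffun f).
Proof.
rewrite wr_ffunJ /wr_logsum [RHS](reindex_inj (mulIg h^-1)).
by apply: eq_bigr => x _; rewrite ffunE.
Qed.

Lemma wr_logsum_at x m : wr_logsum (wr_at x m) = wr_log m.
Proof.
rewrite /wr_logsum (bigD1 x) //= ffunE eqxx big1 ?addr0 // => y yx.
by rewrite ffunE (negPf yx) wr_log1.
Qed.

Lemma wr_logsum1 : wr_logsum 1 = 0%R.
Proof.
by rewrite -(wr_at1 Mt (1 : H)) wr_logsum_at wr_log1.
Qed.

Lemma wr_logsum_N w : w \in N -> wr_logsum w = 0%R.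
Proof.
pose K := [set w | (w \in wr_base_center) && (wr_logsum w == 0%R)].
have KE v : (v \in K) = (v \in wr_base_center) && (wr_logsum v == 0%R) by rewrite inE.
suff : N \subset K by move/subsetP=> sNK /sNK; rewrite KE => /andP[_ /eqP].
have defT : T = @wr_lift Mt H @: [set: H] :> {set W} by rewrite /T wr_topE wr_lift_im.
have gK : group_set K.
  apply/group_setP; split=> [|u v]; rewrite !KE.
    by rewrite (group1 wr_base_center_group) wr_logsum1 eqxx.
  move=> /andP[Zu /eqP su] /andP[Zv /eqP sv]; rewrite wr_logsumM // su sv addr0.
  by rewrite eqxx andbT (groupM (G := wr_base_center_group)).
rewrite (_ : K = Group gK) // gen_subG /= der_wr_base defT.
apply/subsetP=> _ /imset2P[u t Zu Tt ->]; rewrite KE.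
have [h ->] : exists h, t = wr_lift Mt h.
  by case/imsetP: Tt => h; exists h.
have nZ : wr_lift Mt h \in 'N(wr_base_center).
  rewrite -der_wr_base; have := wr_base_norm (wr_lift Mt h).
  by apply: subsetP; apply: char_norms; apply: der_char.
have ZuV : u^-1 \in wr_base_center by exact: (@groupVr _ wr_base_center_group).
have ZuJ : u ^ wr_lift Mt h \in wr_base_center by rewrite memJ_norm.
have -> : [~ u, wr_lift Mt h] \in wr_base_center.
  by rewrite commgEl (groupM (G := wr_base_center_group)).
have /wr_base_centerP[f _ def_u] := Zu.
rewrite /= commgEl wr_logsumM // {2}def_u wr_logsumJ -def_u -wr_logsumM //.
by rewrite mulVg wr_logsum1.
Qed.

End LogSum.

Lemma wr_at_notin_N x m : m \in Z -> wr_at x m \in N -> m = 1.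
Proof.
have /cyclicP[z defZ] : cyclic Z by rewrite prime_cyclic ?oZ.
move=> Zm /(wr_logsum_N defZ); rewrite wr_logsum_at; exact: wr_log_eq0.
Qed.

Let Eq := (B / N)%G.
Let Tq := (T / N)%G.
Let nN w : w \in 'N(N). Proof. by rewrite (subsetP wr_N_norm) ?inE. Qed.
Let nBN : B \subset 'N(N). Proof. by apply/subsetP=> w _. Qed.
Let nTN : T \subset 'N(N). Proof. by apply/subsetP=> w _. Qed.
Let nTB : T \subset 'N(B).
Proof. by apply: subset_trans wr_base_normT; apply: subsetT. Qed.
Let sNB' : N \subset B^`(1).
Proof. by rewrite commg_subl (char_norm_trans _ nTB) ?der_char. Qed.

Lemma wr_N_sub : N \subset B.
Proof. exact: subset_trans sNB' (der_sub 1 B). Qed.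

Lemma wr_quo_der : Eq^`(1) = B^`(1) / N.
Proof. exact: esym (quotient_der 1 nBN). Qed.

Lemma wr_quo_pgroup : p.-group Eq.
Proof.
apply: quotient_pgroup; rewrite /pgroup.
have -> : B = @wr_ffun Mt H @: setT :> {set W}.
  apply/setP=> w; apply/wr_baseP/imsetP=> [[f ->]|[f _ ->]]; first by exists f.
  by exists f.
rewrite card_imset; last by move=> f g [].
rewrite cardsT card_ffun -cardsT pnatX; apply/orP; left; exact: pM.
Qed.

Lemma wr_quo_norm : Tq \subset 'N(Eq).
Proof. exact: quotient_norms. Qed.

Lemma wr_quo_cent_der : Tq \subset 'C(Eq^`(1)).
Proof.
rewrite wr_quo_der quotient_cents2 //; first by rewrite commGC.
exact: subset_trans (der_sub 1 B) nBN.
Qed.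

Lemma wr_quo_TI : Eq :&: Tq = 1.
Proof.
rewrite setIC -quotientIG ?(subset_trans sNB') ?der_sub //.
rewrite (_ : T :&: B = 1) ?quotient1 //.
apply/trivgP/subsetP=> w /setIP[]; rewrite /T wr_topE wr_top_ofE wr_baseE.
by move=> /andP[/eqP w1 _] /eqP w2; apply/set1gP; case: w w1 w2 => f h /= -> ->.
Qed.

Lemma wr_coset_at x m : m \in Z ->
  coset N (wr_at x m) = coset N (wr_at 1 m).
Proof.
move=> Zm; have B'm : wr_at 1 m \in B^`(1).
  rewrite der_wr_base; apply/wr_base_centerP; eexists=> // y.
  by rewrite ffunE; case: ifP.
have Tx : wr_lift Mt x \in T by rewrite /T wr_topE wr_top_ofE eqxx inE.
have := mem_commg B'm Tx; rewrite -/(N : {set W}) => /coset_id c1.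
rewrite -[x in LHS]mul1g -wr_atJ conjg_mulR morphM //=.
by rewrite c1 mulg1.
Qed.

Lemma wr_quo_card_der : #|Eq^`(1)| = p.
Proof.
have /cyclicP[z defZ] : cyclic Z by rewrite prime_cyclic ?oZ.
have Zz : z \in Z by rewrite defZ cycle_id.
pose j := Morphism (D := [set: Mt]) (in2W (@wr_atM Mt H 1)).
have jX k : wr_at 1 (z ^+ k) = wr_at 1 z ^+ k :> W by exact: (morphX j k (in_setT z)).
pose c := coset N (wr_at 1 z).
have oz : #[z] = p by rewrite orderE -defZ.
have oc : #[c] = p.
  apply: nt_prime_order => //.
    by rewrite /c -morphX // -jX -{1}oz expg_order wr_at1 morph1.
  apply/eqP=> /(coset_idr (nN _))/(wr_at_notin_N Zz) z1.
  by move: pr_p; rewrite -oz z1 order1.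
rewrite -oc orderE wr_quo_der; congr #|pred_of_set _|.
have B'z : wr_at 1 z \in B^`(1).
  rewrite der_wr_base; apply/wr_base_centerP; eexists=> // y.
  by rewrite ffunE; case: ifP.
apply/eqP; rewrite eqEsubset cycle_subG mem_quotient // andbT.
rewrite sub_quotient_pre; last exact: subset_trans (der_sub 1 B) nBN.
rewrite der_wr_base; apply/subsetP=> _ /wr_base_centerP[f Zf ->].
rewrite wr_ffun_prod; apply: group_prod => x _; apply/morphpreP; split; first exact: nN.
rewrite -[_ \in _]/(coset N (wr_at x (f x)) \in <[c]>) wr_coset_at //.
have := Zf x; rewrite defZ => /cycleP[k ->].
by rewrite jX morphX ?mem_cycle.
Qed.

Lemma wr_quo_center : Eq^`(1) = 'Z(Eq).
Proof.
apply/eqP; rewrite eqEsubset; apply/andP; split.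
  rewrite subsetI der_sub wr_quo_der der_wr_base.
  exact: quotient_cents wr_base_center_cent.
apply/subsetP=> _ /setIP[/morphimP[w _ /wr_baseP[f ->] ->] /centP cf].
suff B'f : wr_ffun f \in B^`(1) by rewrite wr_quo_der mem_quotient.
rewrite der_wr_base; apply/wr_base_centerP; exists f => // x.
apply/centerP; split=> [|m _]; first by rewrite inE.
apply/commgP/eqP; apply: (@wr_at_notin_N x).
  by rewrite -derM mem_commg ?inE.
have -> : wr_at x [~ f x, m] = [~ wr_ffun f, wr_at x m] :> W.
  rewrite wr_ffunR; congr wr_ffun; apply/ffunP=> y; rewrite !ffunE.
  by case: eqP => [->|]; rewrite ?commg1.
apply: coset_idr => //; rewrite morphR //; apply/eqP/commgP/cf.
by rewrite mem_quotient ?wr_base_at.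
Qed.

Lemma wr_quo_not_cent (A : {group H}) :
  A :!=: 1 -> ~~ (wr_top_of Mt A / N \subset 'C(Eq)).
Proof.
case/trivgPn=> a Aa a1; have [m Zm] : exists m, m \notin Z.
  apply/existsP; rewrite -negb_forall; apply/forallP=> ZM.
  move: pr_p; rewrite -oZ -derM; have /derG1P-> : abelian [set: Mt].
    by apply/centsP=> x _ y _; have /centerP[_] := ZM x; apply; rewrite inE.
  by rewrite cards1.
rewrite quotient_cents2 //; last by apply/subsetP=> w _.
rewrite commGC; apply: contra Zm => sN.
have Aw : wr_lift Mt a \in wr_top_of Mt A by rewrite wr_top_ofE eqxx.
have /(subsetP sN)/(subsetP sNB') := mem_commg (wr_base_at (1 : H) m) Aw.
rewrite der_wr_base commgEl wr_atJ wr_ffunV wr_ffunM inE => /andP[_ /forallP/(_ 1)].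
by rewrite !ffunE eqxx mul1g [1 == a]eq_sym (negPf a1) mulg1 groupV.
Qed.

End WreathQuotient.

(** * One step of the construction *)

Definition monolithic_stage (q : nat) (s : stage) :=
  [/\ st_R s <| st_G s, #|st_R s| = q, solvable (st_G s)
    & forall K : {group st_type s}, K <| st_G s -> K :!=: 1 -> st_R s \subset K].

Lemma stage1_monolithic p : prime p -> monolithic_stage p (stage1 p).
Proof.
move=> pr_p; have oG : #|st_G (stage1 p)| = p by rewrite card_Zp ?prime_gt0.
have prG : prime #|st_G (stage1 p)| by rewrite oG.
split; [exact: (normal_refl (st_G (stage1 p))) | exact: oG | |].
  exact: (@abelian_sol _ (st_G (stage1 p)) (cyclic_abelian (prime_cyclic prG))).
move=> K /andP[sK _] ntK; apply: (@prime_meetG _ (st_G (stage1 p))) => //.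
by rewrite (setIidPr sK).
Qed.

Section StageStep.

Variables (Mt : finGroupType) (s : stage) (p q : nat).
Hypotheses (pr_p : prime p) (pr_q : prime q) (neq_pq : p != q).
Hypotheses (esM : extra_special p [set: Mt]) (mono_s : monolithic_stage q s).

Local Notation G := (st_G s).
Local Notation R := (st_R s).
Local Notation W := (step_W Mt s).
Local Notation N := (step_N Mt s).
Local Notation E := (step_B Mt s).
Local Notation Ht := (step_top Mt s).
Local Notation D := (step_D Mt s).

Let nN (w : W) : w \in 'N(N).
Proof. by rewrite (subsetP (wr_N_norm _ esM)) ?inE. Qed.

Lemma stage_embM : {in G &, {morph @stage_emb Mt s : x y / x * y}}.
Proof.
move=> x y Gx Gy; rewrite /stage_emb subgM // -[RHS](morphM (coset_morphism N)) ?nN //.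
by congr (coset N _); apply: wr_liftM.
Qed.

Canonical stage_emb_morphism := Morphism stage_embM.

Lemma stage_emb_inj : {in G &, injective (@stage_emb Mt s)}.
Proof.
suff : 'injm stage_emb_morphism by move/injmP.
apply/subsetP=> x /morphpreP[Gx /set1P x1].
have /(coset_idr (nN _)) x1' : coset N (wr_lift Mt (subg G x)) = 1 by exact: x1.
have : wr_lift Mt (subg G x) \in wr_base Mt (step_Htype s).
  exact: subsetP (wr_N_sub _ _) _ x1'.
rewrite wr_baseE /= => /eqP /(congr1 sgval); rewrite subgK // => ->.
exact: group1.
Qed.

Lemma stage_emb_im : stage_emb_morphism @* G = Ht.
Proof.
rewrite morphimEdom; apply/setP=> y; apply/imsetP/morphimP.
  case=> x Gx ->; exists (wr_lift Mt (subg G x)); rewrite ?nN //.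
  by rewrite /step_topW wr_topE wr_top_ofE eqxx inE.
case=> w _; rewrite /step_topW wr_topE -wr_lift_im => /imsetP[h _ ->] ->.
by exists (sgval h); rewrite ?subgP // /= /stage_emb sgvalK.
Qed.

Let nsRG : R <| G. Proof. by case: mono_s. Qed.
Let sRG : R \subset G := normal_sub nsRG.
Let Rs := (subg G @* R)%G.

Lemma step_RWE : step_RW Mt s = wr_top_of Mt Rs.
Proof. by rewrite /step_RW /= morphimEsub. Qed.

Lemma stage_emb_imR : stage_emb_morphism @* R = step_RW Mt s / N.
Proof.
rewrite step_RWE morphimEsub //; apply/setP=> y; apply/imsetP/morphimP.
  case=> x Rx ->; exists (wr_lift Mt (subg G x)); rewrite ?nN //.
  by rewrite wr_top_ofE eqxx mem_morphim // (subsetP sRG).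
case=> w _; rewrite -wr_lift_im => /imsetP[h /morphimP[x Gx Rx ->] ->] ->.
by exists x.
Qed.

Let injf : 'injm stage_emb_morphism. Proof. by apply/injmP/stage_emb_inj. Qed.

Lemma step_monoR (K : {group step_type Mt s}) :
  K <| Ht -> K :!=: 1 -> step_RW Mt s / N \subset K.
Proof.
rewrite -stage_emb_im -stage_emb_imR => nsK ntK.
have sK := normal_sub nsK.
rewrite -(morphpreK sK) morphimS //; case: mono_s => _ _ _; apply.
  by rewrite -(morphpre_normal sK (subxx _)) injmK in nsK.
by apply: contra ntK => /eqP K1; rewrite -(morphpreK sK) K1 morphim1.
Qed.

Let nHE : Ht \subset 'N(E) := wr_quo_norm _ _.
Let pE : p.-group E := wr_quo_pgroup _ esM.
Let derE : E^`(1) = 'Z(E) := wr_quo_center _ pr_p esM.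
Let oE' : #|E^`(1)| = p := wr_quo_card_der _ pr_p esM.
Let cHE' : Ht \subset 'C(E^`(1)) := wr_quo_cent_der _ esM.
Let tiEH : E :&: Ht = 1 := wr_quo_TI _ _.
Let Rq := (step_RW Mt s / N)%G.
Let oR : #|R| = q. Proof. by case: mono_s. Qed.
Let nsRH : Rq <| Ht.
Proof. by rewrite /= -stage_emb_im -stage_emb_imR morphim_normal. Qed.
Let oRq : #|Rq| = q. Proof. by rewrite /= -stage_emb_imR card_injm. Qed.
Let coER : coprime #|E| #|Rq|.
Proof.
have [k ->] := p_natP pE.
by rewrite oRq coprimeXl // prime_coprime // dvdn_prime2.
Qed.
Let ncER : ~~ (Rq \subset 'C(E)).
Proof.
rewrite /Rq step_RWE; apply: (wr_quo_not_cent pr_p esM).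
by rewrite morphim_injm_eq1 // ?injm_subg // -cardG_gt1 oR prime_gt1.
Qed.

Lemma step_D_norm : Ht \subset 'N(D).
Proof. exact: comm_norm nsRH. Qed.

Lemma step_D_neq1 : D :!=: 1.
Proof. exact: comm_neq1 ncER. Qed.

Lemma step_D_TI : D :&: Ht = 1.
Proof.
apply/trivgP; rewrite -tiEH setSI // commg_subl.
exact: subset_trans (normal_sub nsRH) nHE.
Qed.

Lemma step_D_comm : [~: D, stage_emb_morphism @* R] = D.
Proof.
rewrite stage_emb_imR; apply: coprime_comm_idem coER (pgroup_sol pE).
exact: subset_trans (normal_sub nsRH) nHE.
Qed.

Lemma step_R_min (K : {group step_type Mt s}) :
  K \subset step_G Mt s -> D \subset 'N(K) -> K :!=: 1 -> step_R Mt s \subset K.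
Proof.
exact: (der_comm_monolith pr_p pE derE oE' nHE cHE' nsRH coER ncER step_monoR).
Qed.

Lemma stage_step_monolithic : monolithic_stage p (stage_step Mt s).
Proof.
have nDG : step_G Mt s \subset 'N(D).
  by rewrite join_subG normG step_D_norm.
have sDG : D \subset step_G Mt s by exact: joing_subl.
split=> /=.
- by rewrite /normal (subset_trans (der_sub 1 D)) // (char_norm_trans (der_char 1 D)).
- by rewrite (der_comm_eq pr_p pE derE oE' nHE cHE' nsRH coER ncER).
- apply: (solvable_comm_ext pE nHE nsRH).
  rewrite -stage_emb_im; apply: morphim_sol.
  by case: mono_s.
move=> K /andP[sK nK] ntK; apply: step_R_min => //.
exact: subset_trans nK.
Qed.

End StageStep.

(** * Unions of monolithic towers *)

Section SubgroupPredicates.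

Variable X : groupType.
Implicit Types (H K N : X -> Prop).

Lemma is_subgroupV K x : is_subgroup K -> K x -> K x^-1.
Proof. by case=> K1 KF Kx; rewrite -div1g; apply: KF. Qed.

Lemma is_subgroupM K x y : is_subgroup K -> K x -> K y -> K (x * y).
Proof.
by move=> gK Kx Ky; rewrite -[y]invgK; apply: gK.2 => //; apply: is_subgroupV.
Qed.

Lemma fin_index_sub H K N : fin_index N H -> (forall x, K x -> H x) -> fin_index N K.
Proof. by case=> s Ns sKH; exists s => h /sKH; apply: Ns. Qed.

Lemma fin_index_infinite K : infinite_set (@setT_pred X) ->
  fin_index K (@setT_pred X) -> infinite_set K.
Proof.
move=> infX [s Ks] r; have [x [_ xr]] := infX [seq y * t | y <- r, t <- s].
have [t ts Kxt] := Ks x I; exists (x * t^-1); split=> //.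
by apply: contra xr => xr; apply/allpairsP; exists (x * t^-1, t); rewrite /= mulgVK.
Qed.

Lemma infinite_uniq H n : infinite_set H ->
  exists s : seq X, [/\ size s = n, uniq s & forall x, x \in s -> H x].
Proof.
move=> infH; elim: n => [|n [s [szs us Hs]]]; first by exists [::].
have [x [Hx xs]] := infH s; exists (x :: s); rewrite /= szs xs us; split=> // y.
by rewrite inE => /predU1P[-> //|]; apply: Hs.
Qed.

(* Pigeonhole: two distinct elements induce the same map on the cosets of [K]. *)
Lemma fin_index_core_neq1 K : infinite_set (@setT_pred X) -> is_subgroup K ->
  fin_index K (@setT_pred X) -> exists2 x, x <> 1 & forall g, K (x ^ g).
Proof.
move=> infX gK [s Ks]; set n := size s.
pose t (i : 'I_n) := nth 1 s i.
have Kt x : exists i, K (x * (t i)^-1).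
  have [_ /(nthP 1)[i lti <-] Kx] := Ks x I.
  by exists (Ordinal lti).
have [e [sze ue _]] := infinite_uniq (n ^ n).+1 infX.
pose c (a : 'I_(n ^ n).+1) := nth 1 e a.
have /fin_all_exists[F KF] a : exists f : {ffun 'I_n -> 'I_n},
    forall i, K (t i * c a * (t (f i))^-1).
  have /fin_all_exists[f Kf] i := Kt (t i * c a).
  by exists (finfun f) => i; rewrite ffunE.
have /injectivePn[a [b ab Fab]] : ~~ injectiveb F.
  apply/injectiveP=> /leq_card; rewrite card_ffun !card_ord; apply/negP.
  by rewrite -ltnNge.
exists (c a * (c b)^-1) => [/divg1_eq/eqP|g].
  by rewrite nth_uniq ?sze ?ltn_ord // (inj_eq val_inj) (negPf ab).
have [i] := Kt g^-1; set k := _ * _ => Kk.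
have -> : (c a * (c b)^-1) ^ g =
    k * ((t i * c a * (t (F a i))^-1) * (t i * c b * (t (F b i))^-1)^-1) * k^-1.
  by rewrite Fab /k /conjg !invgM !invgK !mulgA !mulgVK.
apply: is_subgroupM (is_subgroupV gK Kk) => //; apply: is_subgroupM => //.
exact: gK.2.
Qed.

End SubgroupPredicates.

Section MonolithicTower.

Variables (X : groupType) (Gam E R : nat -> X -> Prop).
Hypothesis GamG : forall k, is_subgroup (Gam k).
Hypothesis Gam_fin : forall k, exists s : seq X, forall x, Gam k x -> x \in s.
Hypothesis Gam_union : forall x, exists k, Gam k x.
Hypothesis GamS : forall k x,
  Gam k.+1 x <-> exists d g, [/\ E k d, Gam k g & x = d * g].
Hypothesis EG : forall k, is_subgroup (E k).
Hypothesis E_norm : forall k d g, E k d -> Gam k.+1 g -> E k (d ^ g).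
Hypothesis E_TI : forall k x, E k x -> Gam k x -> x = 1.
Hypothesis E_neq1 : forall k, exists2 x, E k x & x <> 1.
Hypothesis R_min : forall k (N : X -> Prop), is_subgroup N ->
  (forall n d, N n -> E k d -> N (n ^ d)) ->
  (exists x, [/\ N x, Gam k.+1 x & x <> 1]) -> forall x, R k.+1 x -> N x.
Hypothesis E_comm : forall k (N : X -> Prop), is_subgroup N ->
  (forall n d, N n -> E k d -> N (n ^ d)) ->
  (forall x, R k x -> N x) -> forall x, E k x -> N x.

Lemma tower_subS k x : Gam k x -> Gam k.+1 x.
Proof.
by move=> Gx; apply/GamS; exists 1, x; rewrite mul1g; split=> //; case: (EG k).
Qed.

Lemma tower_sub k j x : (k <= j)%N -> Gam k x -> Gam j x.
Proof.
move=> /subnK<-; elim: (j - k)%N => // n IHn Gx.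
by rewrite addSn; apply/tower_subS/IHn.
Qed.

Lemma tower_seq (s : seq X) : exists k, forall x, x \in s -> Gam k x.
Proof.
elim: s => [|x s [k Gs]]; first by exists 0.
have [j Gx] := Gam_union x; exists (maxn j k) => y.
rewrite inE => /predU1P[->|/Gs]; last exact: tower_sub (leq_maxr _ _).
exact: tower_sub (leq_maxl _ _) Gx.
Qed.

Lemma tower_infinite : infinite_set (@setT_pred X).
Proof.
move=> s; have [k Gs] := tower_seq s; have [x Ex x1] := E_neq1 k.
exists x; split=> //; apply/negP=> /Gs Gx; exact/x1/(E_TI Ex Gx).
Qed.

Lemma tower_fin_index N j0 : is_subgroup N ->
  (forall j x, (j0 <= j)%N -> E j x -> N x) -> fin_index N (@setT_pred X).
Proof.
move=> gN NE; have [s Gs] := Gam_fin j0; exists s => x _.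
have [k Gx] : exists k, Gam (k + j0) x.
  by have [k Gx] := Gam_union x; exists k; apply: tower_sub Gx; apply: leq_addr.
elim: k x Gx => [|k IHk] x Gx.
  by exists x; [exact: Gs | rewrite mulgV; case: gN].
have [d [g [Ed Gg ->]]] := (GamS _ _).1 Gx; have [t ts Ngt] := IHk g Gg.
exists t => //; rewrite -mulgA; apply: is_subgroupM Ngt => //.
by apply: NE Ed; apply: leq_addl.
Qed.

Lemma tower_sub_E N j0 : is_subgroup N ->
  (forall j, (j0 <= j)%N -> forall n d, N n -> E j d -> N (n ^ d)) ->
  (exists n, N n /\ n <> 1) ->
  exists j1, forall j x, (j1 <= j)%N -> E j x -> N x.
Proof.
move=> gN nN [n [Nn n1]]; have [k Gn] := Gam_union n.
exists (maxn k j0).+1 => -[|j] // x; rewrite ltnS geq_max => /andP[kj j0j].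
apply: E_comm => //; first by apply: nN; apply: leqW.
apply: R_min (nN j j0j) _ => //; exists n; split=> //.
exact: tower_sub (leqW kj) Gn.
Qed.

Lemma tower_hereditarily_just_infinite : hereditarily_just_infinite X.
Proof.
split=> [|K gK fK]; first exact: tower_infinite.
split=> [|N gN [_ nNK] ntN]; first exact: fin_index_infinite tower_infinite fK.
have [x x1 Kx] := fin_index_core_neq1 tower_infinite gK fK.
have [j0 KE] : exists j0, forall j y, (j0 <= j)%N -> E j y -> forall g, K (y ^ g).
  apply: (@tower_sub_E (fun y => forall g, K (y ^ g)) 0).
  - split=> [g|y z Ky Kz g]; first by rewrite conj1g; case: gK.
    by rewrite conjMg conjVg; apply: gK.2.
  - by move=> j _ n d Kn _ g; rewrite -conjgM.
  by exists x.
have [|j1 NE] := @tower_sub_E N j0 gN _ ntN.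
  by move=> j j0j n d Nn Ed; apply: nNK => //; rewrite -[d]conjg1; apply: KE Ed _.
by apply: fin_index_sub (tower_fin_index gN NE) _.
Qed.

(* [trail i j] is [E (i + j - 1) ... E (i + 1) E i], the kernel of the
   retraction of [Gam (i + j)] onto [Gam i]. *)
Fixpoint trail i j : X -> Prop :=
  if j is j'.+1 then
    fun x => exists d t, [/\ E (i + j') d, trail i j' t & x = d * t]
  else fun x => x = 1.

Lemma trail_sub i j x : trail i j x -> Gam (i + j) x.
Proof.
elim: j x => [|j IHj] x /=; first by move->; case: (GamG (i + 0)).
case=> d [t [Ed Tt ->]]; rewrite addnS; apply/GamS; exists d, t; split=> //.
exact: IHj.
Qed.

Lemma trail_TI i j x : trail i j x -> Gam i x -> x = 1.
Proof.
elim: j x => [|j IHj] x //= [d [t [Ed Tt ->]]] Gx.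
have Gt := trail_sub Tt; have gG := GamG (i + j).
have d1 : d = 1.
  apply: E_TI Ed _; rewrite -(mulgK t d); apply: gG.2 => //.
  exact: tower_sub (leq_addr _ _) Gx.
by rewrite d1 mul1g in Gx *; apply: IHj.
Qed.

Lemma trail_normal i j x g : trail i j x -> Gam (i + j) g -> trail i j (x ^ g).
Proof.
elim: j x g => [|j IHj] x g /=; first by move=> -> _; rewrite conj1g.
case=> d [t [Ed Tt ->]]; rewrite addnS => Gg.
have [e [h [Ee Gh def_g]]] := (GamS _ _).1 Gg.
have Gt : Gam (i + j).+1 t by apply/tower_subS/trail_sub.
exists (d ^ g * ((e^-1 * e ^ t^-1) ^ h)), (t ^ h); split.
- apply: is_subgroupM (E_norm Ed Gg) _ => //; apply: E_norm (tower_subS Gh).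
  apply: is_subgroupM (is_subgroupV _ Ee) _ => //; apply: E_norm Ee _.
  exact: is_subgroupV.
- exact: IHj.
rewrite conjMg -[RHS]mulgA; congr (_ * _).
rewrite -conjMg def_g conjgM; congr (_ ^ _).
by rewrite /conjg invgK !mulgA mulgVK.
Qed.

Lemma trail_subgroup i j : is_subgroup (trail i j).
Proof.
elim: j => [|j IHj] /=; first by split=> // x y -> ->; rewrite mulgV.
split; first by exists 1, 1; rewrite mulg1; split; [case: (EG (i + j)) | case: IHj |].
move=> _ _ [d [t [Ed Tt ->]]] [e [u [Ee Tu ->]]].
have Gtu : Gam (i + j).+1 (t * u^-1).
  by apply/tower_subS/(trail_sub (j := j)); apply: IHj.2.
exists (d * (e^-1 ^ (t * u^-1)^-1)), (t * u^-1); split.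
- apply: is_subgroupM => //; apply: E_norm; first exact: is_subgroupV.
  exact: is_subgroupV.
- exact: IHj.2.
have -> : d * t * (e * u)^-1 = d * (t * u^-1) * e^-1 by rewrite invgM !mulgA.
by rewrite /conjg invgK; move: (t * u^-1) => v; rewrite !mulgA mulgVK.
Qed.

Lemma trail_mono i j k x : (j <= k)%N -> trail i j x -> trail i k x.
Proof.
move=> /subnK<-; elim: (k - j)%N => // n IHn Tx.
rewrite addSn; exists 1, x; rewrite mul1g; split=> //; last exact: IHn.
by case: (EG (i + (n + j))).
Qed.

Lemma tower_residually_finite : residually_finite X.
Proof.
move=> x x1; have [i Gx] := Gam_union x.
have gT : is_subgroup (fun y => exists j, trail i j y).
  split=> [|y z [j Ty] [k Tz]]; first by exists 0.
  exists (maxn j k); apply: (trail_subgroup i _).2.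
    exact: trail_mono (leq_maxl _ _) Ty.
  exact: trail_mono (leq_maxr _ _) Tz.
exists (fun y => exists j, trail i j y); split=> //.
- split=> // y g [j Ty] _; have [k Gg] := Gam_union g.
  exists (maxn j k); apply: trail_normal (trail_mono (leq_maxl _ _) Ty) _.
  by apply: tower_sub Gg; apply: leq_trans (leq_maxr j k) (leq_addl _ _).
- apply: (@tower_fin_index _ i) => // j y /subnKC<- Ey.
  exists (j - i).+1; exists y, 1; rewrite mulg1; split=> //.
  by case: (trail_subgroup i (j - i)).
by case=> j Tx; apply: x1; apply: trail_TI Tx Gx.
Qed.

End MonolithicTower.

Section FiniteSubgroupEmbedding.

Variables (gT : finGroupType) (G : {group gT}) (X : groupType) (f : gT -> X).
Hypothesis fM : {in G &, {morph f : x y / x * y}}.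
Implicit Types (A : {set gT}) (H : {group gT}) (N : X -> Prop).

Definition emb_image A : X -> Prop := fun x => exists2 a, a \in A & x = f a.

Lemma emb1 : f 1 = 1.
Proof. by apply: (mulgI (f 1)); rewrite -fM ?group1 // !mulg1. Qed.

Lemma embV : {in G, {morph f : x / x^-1}}.
Proof.
by move=> x Gx; apply: (mulgI (f x)); rewrite -fM ?groupV // !mulgV emb1.
Qed.

Lemma embJ : {in G &, {morph f : x y / x ^ y}}.
Proof. by move=> x y Gx Gy; rewrite /conjg !fM ?embV ?groupM ?groupV. Qed.

Lemma embR : {in G &, {morph f : x y / [~ x, y]}}.
Proof. by move=> x y Gx Gy; rewrite /commg fM ?embV ?embJ ?groupJ ?groupV. Qed.

Lemma embX x n : x \in G -> f (x ^+ n) = f x ^+ n.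
Proof.
move=> Gx; elim: n => [|n IHn]; first by rewrite !expg0 emb1.
by rewrite !expgS fM ?groupX // IHn.
Qed.

Lemma emb_image_subgroup H : H \subset G -> is_subgroup (emb_image H).
Proof.
move/subsetP=> sHG; split=> [|_ _ [x Hx ->] [y Hy ->]].
  by exists 1; rewrite ?group1 ?emb1.
exists (x * y^-1); first by rewrite groupM ?groupV.
by rewrite fM ?embV ?groupV ?sHG.
Qed.

Lemma emb_gen A N : A \subset G -> is_subgroup N ->
  (forall a, a \in A -> N (f a)) -> forall a, a \in <<A>> -> N (f a).
Proof.
move=> /subsetP sAG gN NA _ /gen_prodgP[n [c Ac ->]].
suff [] : N (f (\prod_i c i)) /\ \prod_i c i \in G by [].
apply: (big_ind (fun x => N (f x) /\ x \in G)) => [|x y [Nx Gx] [Ny Gy]|i _].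
- by rewrite emb1 group1; split=> //; case: gN.
- by rewrite fM ?groupM //; split=> //; apply: is_subgroupM.
by split; [apply: NA | apply: sAG]; apply: Ac.
Qed.

Lemma derived_sub_emb H N : H \subset G -> (forall x, N x -> emb_image H x) ->
  forall x, derived_sub N x -> emb_image H^`(1) x.
Proof.
move=> sHG NH x; apply.
  by apply: emb_image_subgroup; apply: subset_trans (der_sub 1 H) sHG.
move=> _ [a [b [/NH[y Hy ->] [/NH[z Hz ->] ->]]]].
exists [~ y, z]; first exact: mem_commg.
by rewrite embR ?(subsetP sHG).
Qed.

Lemma soluble_sub_emb N : solvable G -> (forall x, N x -> emb_image G x) ->
  soluble_sub N.
Proof.
move=> /derivedP[n Gn1] NG; exists n => x.
suff sub k y : iter k (@derived_sub X) N y -> emb_image G^`(k) y.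
  by move/sub; rewrite Gn1 => -[a /set1P-> ->]; rewrite emb1.
elim: k y => [|k IHk] y; first exact: NG.
rewrite dergSn; apply: (derived_sub_emb (H := G^`(k)%G)) => //.
exact: der_sub.
Qed.

End FiniteSubgroupEmbedding.

Section TowerUnion.

Variables (p : nat -> nat) (M : nat -> finGroupType).
Hypothesis p_prime : forall i, (0 < i)%N -> prime (p i).
Hypothesis p_neq : forall i, (0 < i)%N -> p i.+1 != p i.
Hypothesis M_es : forall i, (1 < i)%N -> extra_special (p i) [set: M i].

Let S k := tower p M k.+1.
Let D k := step_D (M k.+2) (S k).

Lemma tower_monolithic k : monolithic_stage (p k.+1) (S k).
Proof.
elim: k => [|k IHk]; first exact/stage1_monolithic/p_prime.
apply: stage_step_monolithic IHk; [exact: p_prime | exact: p_prime | |].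
  exact: p_neq.
exact: M_es.
Qed.

Variables (X : groupType) (f : forall k, st_type (S k) -> X).
Arguments f : clear implicits.
Hypothesis fM : forall k, {in st_G (S k) &, {morph f k : x y / x * y}}.
Hypothesis f_inj : forall k, {in st_G (S k) &, injective (f k)}.
Hypothesis f_compat : forall k, {in st_G (S k),
  forall g, f k.+1 (@stage_emb (M k.+2) (S k) g) = f k g}.
Hypothesis f_union : forall x, exists k, emb_image (f k) (st_G (S k)) x.

Let Gam k := emb_image (f k) (st_G (S k)).
Let E k := emb_image (f k.+1) (D k).
Let R k := emb_image (f k) (st_R (S k)).

Let pr k : prime (p k.+1). Proof. exact: p_prime. Qed.
Let neq k : p k.+2 != p k.+1. Proof. exact: p_neq. Qed.
Let es k : extra_special (p k.+2) [set: M k.+2]. Proof. exact: M_es. Qed.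
Let emb k := @stage_emb_morphism (M k.+2) (S k) (p k.+2) (es k).

Let defG k : st_G (S k.+1) = D k * emb k @* st_G (S k) :> {set _}.
Proof.
rewrite stage_emb_im /= norm_joinEr //.
exact: step_D_norm (tower_monolithic k).
Qed.

Let sDG k : D k \subset st_G (S k.+1).
Proof. by rewrite defG mulG_subl. Qed.

Let DG k d : d \in D k -> d \in st_G (S k.+1).
Proof. exact: subsetP (sDG k) d. Qed.

Let embG k g : g \in st_G (S k) -> emb k g \in st_G (S k.+1).
Proof.
move=> Gg; rewrite defG; apply: (subsetP (mulG_subr _ _)).
by rewrite mem_morphim.
Qed.

Let GamG k : is_subgroup (Gam k).
Proof. exact: emb_image_subgroup. Qed.

Let Gam_fin k : exists s : seq X, forall x, Gam k x -> x \in s.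
Proof.
exists [seq f k g | g <- enum (st_G (S k))] => _ [g Gg ->].
by rewrite map_f // mem_enum.
Qed.

Let GamS k x : Gam k.+1 x <-> exists d g, [/\ E k d, Gam k g & x = d * g].
Proof.
split=> [[y Gy ->]|[_ [_ [[d Dd ->] [g Gg ->] ->]]]].
  move: Gy; rewrite defG => /mulsgP[d _ Dd /morphimP[g Gg _ ->] ->].
  exists (f k.+1 d), (f k g); split; [by exists d | by exists g |].
  by rewrite -(f_compat Gg) (fM (DG Dd) (embG Gg)).
exists (d * emb k g); first exact: groupM (DG Dd) (embG Gg).
by rewrite (fM (DG Dd) (embG Gg)) f_compat.
Qed.

Let EG k : is_subgroup (E k).
Proof. exact: (emb_image_subgroup (fM (k := k.+1)) (sDG k)). Qed.

Let nDG k : st_G (S k.+1) \subset 'N(D k).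
Proof.
rewrite defG stage_emb_im mul_subG ?normG //.
exact: step_D_norm (tower_monolithic k).
Qed.

Let E_norm k d g : E k d -> Gam k.+1 g -> E k (d ^ g).
Proof.
move=> [a Da ->] [b Gb ->]; exists (a ^ b).
  by rewrite memJ_norm ?(subsetP (nDG k)).
by rewrite (embJ (fM (k := k.+1)) (DG Da) Gb).
Qed.

Let E_TI k x : E k x -> Gam k x -> x = 1.
Proof.
move=> [d Dd ->] [g Gg]; rewrite -(f_compat Gg) => fdg.
have def_d : d = emb k g := f_inj (DG Dd) (embG Gg) fdg.
suff -> : d = 1 by exact: (emb1 (fM (k := k.+1))).
apply/set1gP; rewrite -(step_D_TI (es k) (tower_monolithic k)).
by rewrite inE Dd -(stage_emb_im _ (es k)) def_d mem_morphim.
Qed.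

Let E_neq1 k : exists2 x, E k x & x <> 1.
Proof.
have /trivgPn[d Dd d1] :=
  step_D_neq1 (pr k.+1) (pr k) (es k) (tower_monolithic k).
exists (f k.+1 d); first by exists d.
rewrite -(emb1 (fM (k := k.+1))) => fd1; move/eqP: d1; apply.
exact: f_inj (DG Dd) (group1 _) fd1.
Qed.

Let R_min k (N : X -> Prop) : is_subgroup N ->
  (forall n d, N n -> E k d -> N (n ^ d)) ->
  (exists x, [/\ N x, Gam k.+1 x & x <> 1]) -> forall x, R k.+1 x -> N x.
Proof.
move=> gN nN [x [Nx [g Gg def_x] g1]] _ [r Rr ->]; rewrite {}def_x in Nx g1 *.
have sgG : g ^: D k \subset st_G (S k.+1).
  by rewrite class_subG // sDG.
have : r \in <<g ^: D k>>.
  apply: subsetP r Rr.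
  apply: (step_R_min (pr k.+1) (pr k) (neq k) (es k) (tower_monolithic k)).
  - by rewrite gen_subG.
  - by rewrite norms_gen ?class_norm.
  apply/trivgPn; exists g; first by rewrite mem_gen ?class_refl.
  by apply/eqP=> g1'; apply: g1; rewrite g1' (emb1 (fM (k := k.+1))).
apply: (emb_gen (fM (k := k.+1))) => // _ /imsetP[d Dd ->].
by rewrite (embJ (fM (k := k.+1)) Gg (DG Dd)); apply: nN => //; exists d.
Qed.

Let E_comm k (N : X -> Prop) : is_subgroup N ->
  (forall n d, N n -> E k d -> N (n ^ d)) ->
  (forall x, R k x -> N x) -> forall x, E k x -> N x.
Proof.
move=> gN nN NR _ [a Da ->].
have sRG : st_R (S k) \subset st_G (S k).
  by have [/normal_sub] := tower_monolithic k.
have : a \in [~: D k, emb k @* st_R (S k)].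
  by rewrite (step_D_comm (pr k.+1) (pr k) (neq k) (es k) (tower_monolithic k)).
have sDRG : commg_set (D k) (emb k @* st_R (S k)) \subset st_G (S k.+1).
  apply/subsetP=> _ /imset2P[d _ Dd /morphimP[r Gr _ ->] ->].
  exact: groupR (DG Dd) (embG Gr).
apply: (emb_gen (fM (k := k.+1))) => // _ /imset2P[d _ Dd /morphimP[r Gr Rr ->] ->].
rewrite (embR (fM (k := k.+1)) (DG Dd) (embG Gr)).
have Nr : N (f k.+1 (emb k r)) by apply: NR; exists r; rewrite // f_compat.
rewrite commgEr; apply: is_subgroupM => //; apply: nN; last by exists d.
exact: is_subgroupV.
Qed.

Lemma tower_union_periodic : periodic_group X.
Proof.
move=> x; have [k [g Gg ->]] := f_union x.
exists #[g]; first exact: order_gt0.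
by rewrite -(embX (fM (k := k))) // expg_order (emb1 (fM (k := k))).
Qed.

Lemma tower_union_locally_soluble : locally_soluble X.
Proof.
move=> s; have [k Gs] := tower_seq f_union GamS EG s.
have [_ _ solG _] := tower_monolithic k.
by apply: (soluble_sub_emb (fM (k := k)) solG) => x; apply; [apply: GamG | apply: Gs].
Qed.

Lemma tower_union_properties :
  [/\ periodic_group X, locally_soluble X, residually_finite X
    & hereditarily_just_infinite X].
Proof.
split.
- exact: tower_union_periodic.
- exact: tower_union_locally_soluble.
- exact: (tower_residually_finite GamG Gam_fin f_union GamS EG E_norm E_TI).
exact: (tower_hereditarily_just_infinite Gam_fin f_union GamS EG E_TI E_neq1
          R_min E_comm).
Qed.

End TowerUnion.

Theorem theorem2p7
  (p : nat -> nat) (M : nat -> finGroupType)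
  (p_prime : forall i, (0 < i)%N -> prime (p i))
  (p_neq : forall i, (0 < i)%N -> p i.+1 != p i)
  (M_es : forall i, (1 < i)%N ->
     extra_special (p i) [set: M i] /\ #|[set: M i]| = (p i ^ 3)%N)
  (X : groupType)
  (phi : forall i, st_type (tower p M i) -> X)
  (phi_morph : forall i, (0 < i)%N ->
     {in st_G (tower p M i) &, {morph phi i : x y / (x * y)%g}})
  (phi_inj : forall i, (0 < i)%N -> {in st_G (tower p M i) &, injective (phi i)})
  (phi_compat : forall k, {in st_G (tower p M k.+1),
     forall g, phi k.+2 (@tower_emb p M k g) = phi k.+1 g})
  (phi_union : forall x : X,
     exists i, (0 < i)%N /\ exists2 g, g \in st_G (tower p M i) & x = phi i g) :
  [/\ periodic_group X, locally_soluble X, residually_finite X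
    & hereditarily_just_infinite X].
Proof.
apply: (@tower_union_properties p M p_prime p_neq _ X (fun k => phi k.+1)).
- by move=> i /M_es[].
- by move=> k; apply: phi_morph.
- by move=> k; apply: phi_inj.
- exact: phi_compat.
move=> x; have [i [i_gt0 [g Gg ->]]] := phi_union x.
by case: i i_gt0 g Gg => // k _ g Gg; exists k, g.
Qed.
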